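(* Let $q_1,q_2:\mathbb R^n\to\mathbb R$ be quadratic functions, and suppose there exists $\hat\gamma\in\mathbb R_+^2$ such that $A[\hat\gamma]\succ 0$. Let $\gamma^{(1)},\gamma^{(2)}\in\mathbb R_+^2$ be generators of $\Gamma_1$, i.e., $\Gamma_1=\operatorname{cone}(\{\gamma^{(1)},\gamma^{(2)}\})$. (1) $\operatorname{conv}(\hat{\mathcal S})=\hat{\mathcal S}_{\mathrm{SDP}}$ if and only if both of the following requirements hold: (a) if $\gamma^{(1)}\in\mathbb R_{++}^2$ and there exists $x\in\mathbb R^n$ such that $[\gamma^{(1)},q(x)]=0$ and $[\gamma^{(2)},q(x)]<0$, then $\ker(A[\gamma^{(1)}])\cap b[\gamma^{(1)}]^\perp$ is nontrivial (i.e., $\neq\{0\}$); (b) if $\gamma^{(2)}\in\mathbb R_{++}^2$ and there exists $x\in\mathbb R^n$ such that $[\gamma^{(2)},q(x)]=0$ and $[\gamma^{(1)},q(x)]<0$, then $\ker(A[\gamma^{(2)}])\cap b[\gamma^{(2)}]^\perp$ is nontrivial. (2) In particular, if in addition $q_1$ and $q_2$ are both nonconvex and there exists $\hat x\in\mathbb R^n$ such that $q_1(\hat x)<0$ and $q_2(\hat x)<0$, then $\operatorname{conv}(\hat{\mathcal S})=\hat{\mathcal S}_{\mathrm{SDP}}$ if and only if for both $i=1,2$ the subspace $\ker(A[\gamma^{(i)}])\cap b[\gamma^{(i)}]^\perp$ is nontrivial.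
   Context: Let $n$ be a positive integer and $\mathbb S^n$ the real symmetric $n\times n$ matrices with trace inner product. For $i=1,2$ let $q_i(x)=x^\top A_ix+2b_i^\top x+c_i$ with $A_i\in\mathbb S^n$, $b_i\in\mathbb R^n$, $c_i\in\mathbb R$. (The objective is taken to be identically zero.) For $\gamma=(\gamma_1,\gamma_2)\in\mathbb R^2$ let $A[\gamma]=\gamma_1A_1+\gamma_2A_2$, $b[\gamma]=\gamma_1b_1+\gamma_2b_2$, and $[\gamma,q(x)]=\gamma_1q_1(x)+\gamma_2q_2(x)$. Let $$\Gamma_1=\{\gamma\in\mathbb R_+^2: A[\gamma]\succeq 0\},$$ which is a closed convex cone in $\mathbb R^2$. $\mathbb R^2_{++}$ denotes vectors with both entries strictly positive, and $\operatorname{cone}$ denotes the convex conic hull. For $v\in\mathbb R^n$, $v^\perp=\{y\in\mathbb R^n:\langle v,y\rangle=0\}$. Define $$\hat{\mathcal S}=\{x\in\mathbb R^n: q_1(x)\le 0,\ q_2(x)\le 0\},$$ $$\hat{\mathcal S}_{\mathrm{SDP}}=\{x\in\mathbb R^n:\ \exists X\in\mathbb S^n,\ X\succeq xx^\top,\ \langle A_i,X\rangle+2b_i^\top x+c_i\le 0\ \text{ for } i=1,2\}.$$ *)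

(* Defs.v *)
From HB Require Import structures.
From mathcomp Require Import all_boot all_order all_algebra.
From mathcomp Require Import boolp classical_sets reals convex.

Set Implicit Arguments.
Unset Strict Implicit.
Unset Printing Implicit Defensive.

Import Order.TTheory GRing.Theory Num.Theory.
Local Open Scope classical_set_scope.
Local Open Scope ring_scope.

(* Trace inner product; on column vectors (n = 1) it is the Euclidean one. *)
Definition inner (R : realType) (m n : nat) (U V : 'M[R]_(m, n)) : R :=
  \tr (U^T *m V).

Definition possemidef (R : realType) (n : nat) (M : 'M[R]_n) : Prop :=
  M \is symmetricmx /\ forall y : 'cV[R]_n, 0 <= inner y (M *m y).

Definition posdef (R : realType) (n : nat) (M : 'M[R]_n) : Prop :=
  M \is symmetricmx /\ forall y : 'cV[R]_n, y != 0 -> 0 < inner y (M *m y).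

Definition convex_hull (R : realType) (E : lmodType R) (S : set E) : set E :=
  smallest (@convex_set R E) S.

Definition convex_cone (R : realType) (E : lmodType R) (K : set E) : Prop :=
  [/\ K 0,
      forall u v, K u -> K v -> K (u + v)
    & forall (a : R) u, 0 <= a -> K u -> K (a *: u)].

Definition conic_hull (R : realType) (E : lmodType R) (S : set E) : set E :=
  smallest (@convex_cone R E) S.

Definition kernel (R : realType) (n : nat) (M : 'M[R]_n) : set 'cV[R]_n :=
  [set y | M *m y = 0].

Definition orthogonal (R : realType) (n : nat) (v : 'cV[R]_n) :
    set 'cV[R]_n :=
  [set y | inner v y = 0].

Definition nonneg_orthant (R : realType) (m : nat) : set 'cV[R]_m :=
  [set g | forall i, 0 <= g i 0].

Definition pos_orthant (R : realType) (m : nat) : set 'cV[R]_m :=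
  [set g | forall i, 0 < g i 0].

Definition quad (R : realType) (n : nat) (A : 'M[R]_n) (b : 'cV[R]_n) (c : R)
    (x : 'cV[R]_n) : R :=
  inner x (A *m x) + 2 * inner b x + c.

(* A[gamma] for E = matrices, b[gamma] for E = column vectors. *)
Definition aggregate (R : realType) (E : lmodType R) (m : nat)
    (v : 'I_m -> E) (g : 'cV[R]_m) : E :=
  \sum_(i < m) g i 0 *: v i.

Definition agg_quad (R : realType) (n m : nat) (A : 'I_m -> 'M[R]_n)
    (b : 'I_m -> 'cV[R]_n) (c : 'I_m -> R) (g : 'cV[R]_m) (x : 'cV[R]_n) : R :=
  \sum_(i < m) g i 0 * quad (A i) (b i) (c i) x.

Definition Gamma1 (R : realType) (n m : nat) (A : 'I_m -> 'M[R]_n) :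
    set 'cV[R]_m :=
  [set g | nonneg_orthant g /\ possemidef (aggregate A g)].

Definition feasible (R : realType) (n m : nat) (A : 'I_m -> 'M[R]_n)
    (b : 'I_m -> 'cV[R]_n) (c : 'I_m -> R) : set 'cV[R]_n :=
  [set x | forall i, quad (A i) (b i) (c i) x <= 0].

Definition feasible_SDP (R : realType) (n m : nat) (A : 'I_m -> 'M[R]_n)
    (b : 'I_m -> 'cV[R]_n) (c : 'I_m -> R) : set 'cV[R]_n :=
  [set x | exists X : 'M[R]_n,
     [/\ X \is symmetricmx,
         possemidef (X - x *m x^T)
       & forall i, inner (A i) X + 2 * inner (b i) x + c i <= 0]].

Definition ker_perp (R : realType) (n m : nat) (A : 'I_m -> 'M[R]_n)
    (b : 'I_m -> 'cV[R]_n) (g : 'cV[R]_m) : set 'cV[R]_n :=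
  kernel (aggregate A g) `&` orthogonal (aggregate b g).

(* Main.v *)
Require Import Defs.
From HB Require Import structures.
From mathcomp Require Import all_boot all_order all_algebra.
From mathcomp Require Import boolp classical_sets reals convex.
From mathcomp Require Import interval_inference.
From mathcomp Require Import ring lra.

Set Implicit Arguments.
Unset Strict Implicit.
Unset Printing Implicit Defensive.

Import Order.TTheory GRing.Theory Num.Theory.
Local Open Scope classical_set_scope.
Local Open Scope ring_scope.

(** Write [Q_g = agg_quad A b c g] for the aggregated quadratic of a weight
    vector [g].

    Duality.  Peeling rank-one terms off a positive semidefinite matrix shows
    that two such matrices have a nonnegative inner product, so every point of
    the SDP relaxation satisfies [Q_g <= 0] for each [g] in the cone [Gamma1].
    Conversely, the relaxation equals the set [T] where [Q_g1 <= 0] and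
    [Q_g2 <= 0].  The positive definite aggregate makes [Gamma1]
    two-dimensional, so [D = g i * h j - g j * h i] is positive for one of the
    two labellings [(i, j)] of the constraints, where [(g, h) = (g1, g2)].
    This condition is symmetric under [(i, g) <-> (j, h)], and
    [D q_i = h_j Q_g - g_j Q_h].  Hence a point of [T] that violates [q_i]
    forces [g > 0] entrywise.  Then [A[g]] is singular, since otherwise [g]
    could be moved away from [h] inside [Gamma1]; its nonzero kernel vectors
    [y] satisfy [y^T A_i y < 0], and adding a multiple of [y y^T] to [x x^T]
    gives the required matrix ([lift_SDP]).

    Sufficiency ([violated_in_convex_hull]).  From a point of [T] violating
    [q_i], move in both directions along a kernel vector [w] of [A[g]] until
    [q_i] vanishes.  On this line [Q_g] is affine.  If [w] is orthogonal to
    [b[g]] then [Q_g] is constant and both endpoints are feasible.  If only the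
    zero vector lies in
    [ker_perp A b g], an infeasible endpoint would produce a point on the line
    with [Q_g = 0 < q_i], that is with [Q_g = 0] and [Q_h < 0], against the
    hypothesis.  So the point lies on a segment between two feasible points.

    Necessity ([face_extreme]).  A point [x] with [Q_g x = 0], [Q_h x < 0] and
    [g > 0] belongs to [T] and violates [q_i].  If [ker_perp A b g] is trivial,
    then [x] is an extreme point of [{Q_g <= 0}]: a segment of that set through
    [x] has its direction in the kernel of [A[g]] and orthogonal to [b[g]].
    Removing [x] leaves a convex set that contains the feasible set.

    Nonconvex constraints.  If neither [A_i] is positive semidefinite then both
    generators are entrywise positive.  From a Slater point, moving along a
    kernel vector of [A[h]], oriented so that [Q_h] does not increase, makes
    [Q_g] grow to infinity and hence cross zero ([face_witness]); so the
    premise of each requirement holds. *)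

(** * Positive semidefinite forms *)

Section Inner.
Variables (R : realType) (n : nat).
Implicit Types (u v w x y : 'cV[R]_n) (M B P Y : 'M[R]_n) (s t : R).

Lemma symmetricmxP M : M \is symmetricmx <-> M^T = M.
Proof.
split=> [/is_hermitianmxP|] h.
  by rewrite [RHS]h expr0 scale1r map_mx_id.
by apply/is_hermitianmxP; rewrite expr0 scale1r map_mx_id.
Qed.

Lemma inner_coord u v : inner u v = \sum_i u i 0 * v i 0.
Proof.
rewrite /inner trace_mx11 mxE; apply: eq_bigr => i _.
by rewrite mxE.
Qed.

Lemma innerC m p (U V : 'M[R]_(m, p)) : inner U V = inner V U.
Proof. by rewrite /inner -mxtrace_tr trmx_mul trmxK. Qed.

Lemma innerDr m p (U V W : 'M[R]_(m, p)) :
  inner U (V + W) = inner U V + inner U W.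
Proof. by rewrite /inner mulmxDr mxtraceD. Qed.

Lemma innerZr m p t (U V : 'M[R]_(m, p)) : inner U (t *: V) = t * inner U V.
Proof. by rewrite /inner -scalemxAr mxtraceZ. Qed.

Lemma innerDl m p (U V W : 'M[R]_(m, p)) :
  inner (U + V) W = inner U W + inner V W.
Proof. by rewrite !(innerC _ W) innerDr. Qed.

Lemma innerZl m p t (U V : 'M[R]_(m, p)) : inner (t *: U) V = t * inner U V.
Proof. by rewrite !(innerC _ V) innerZr. Qed.

Lemma inner0r m p (U : 'M[R]_(m, p)) : inner U 0 = 0.
Proof. by rewrite /inner mulmx0 mxtrace0. Qed.

Lemma inner0l m p (U : 'M[R]_(m, p)) : inner 0 U = 0.
Proof. by rewrite innerC inner0r. Qed.

Lemma inner_trmx M x y : inner x (M *m y) = inner (M^T *m x) y.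
Proof. by rewrite /inner mulmxA trmx_mul trmxK. Qed.

Lemma inner_sym M x y : M \is symmetricmx ->
  inner x (M *m y) = inner y (M *m x).
Proof. by move=> /symmetricmxP h; rewrite inner_trmx h innerC. Qed.

Lemma symmetricmxD M B : M \is symmetricmx -> B \is symmetricmx ->
  M + B \is symmetricmx.
Proof.
move=> /symmetricmxP hM /symmetricmxP hB.
by apply/symmetricmxP; rewrite linearD /= hM hB.
Qed.

Lemma symmetricmxZ t M : M \is symmetricmx -> t *: M \is symmetricmx.
Proof.
by move=> /symmetricmxP hM; apply/symmetricmxP; rewrite linearZ /= hM.
Qed.

Lemma symmetricmx_rank1 x : x *m x^T \is symmetricmx.
Proof. by apply/symmetricmxP; rewrite trmx_mul trmxK. Qed.

Lemma inner_mulmx_rank1 M x : inner M (x *m x^T) = inner x (M *m x).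
Proof.
rewrite {1}/inner mulmxA mxtrace_mulC -/(inner x (M^T *m x)).
by rewrite inner_trmx trmxK innerC.
Qed.

Lemma qform_rank1 x y : inner y (x *m x^T *m y) = inner x y ^+ 2.
Proof.
rewrite /inner -mulmxA mulmxA mxtrace_mulC trace_mx11 mxE big_ord1.
by rewrite -!trace_mx11 -/(inner x y) -/(inner y x) innerC expr2.
Qed.

Lemma qform_comb M x y s t : M \is symmetricmx ->
  inner (s *: x + t *: y) (M *m (s *: x + t *: y)) =
  s ^+ 2 * inner x (M *m x) + 2 * s * t * inner x (M *m y)
  + t ^+ 2 * inner y (M *m y).
Proof.
move=> hM; rewrite mulmxDr -!scalemxAr !innerDl !innerDr !innerZl !innerZr.
rewrite (inner_sym y x hM); ring.
Qed.

(** Cauchy-Schwarz for the semi-inner product defined by [M]. *)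
Lemma qform_CauchySchwarz M x y : possemidef M ->
  inner x (M *m y) ^+ 2 <= inner x (M *m x) * inner y (M *m y).
Proof.
move=> [hM hp].
have hq s t := hp (s *: x + t *: y).
have hx := hp x; have hy := hp y.
move: hq; set a := inner x (M *m x); set c := inner y (M *m y) => hq.
set b := inner x (M *m y).
have H s t : 0 <= s ^+ 2 * a + 2 * s * t * b + t ^+ 2 * c.
  by have := hq s t; rewrite qform_comb.
rewrite -/a in hx; rewrite -/c in hy.
have [c0|c0] := eqVneq c 0; last first.
  have := H c (- b); have cp : 0 < c by rewrite lt_neqAle eq_sym c0.
  have -> : c ^+ 2 * a + 2 * c * (- b) * b + (- b) ^+ 2 * c =
    c * (a * c - b ^+ 2) by ring.
  by rewrite pmulr_rge0 // subr_ge0.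
(* For [c = 0] these coefficients give [- (a + 2) * b ^+ 2 >= 0]. *)
have := H b (- (a + 1)); rewrite c0 => h.
have h2 := sqr_ge0 b.
have h3 : 0 <= a * b ^+ 2 by apply: mulr_ge0.
rewrite mulr0; nra.
Qed.

Lemma inner_delta (i : 'I_n) x : inner (delta_mx i 0) x = x i 0.
Proof.
rewrite inner_coord (bigD1 i) //= big1 ?addr0 => [|k kn].
  by rewrite mxE !eqxx mul1r.
by rewrite mxE (negbTE kn) mul0r.
Qed.

Lemma mulmx_delta M (i k : 'I_n) : (M *m (delta_mx i 0 : 'cV[R]_n)) k 0 = M k i.
Proof. by rewrite -colE mxE. Qed.

Lemma possemidef_ker M y : possemidef M -> inner y (M *m y) = 0 -> M *m y = 0.
Proof.
move=> hM hy; apply/matrixP => i j; rewrite (ord1 j) [RHS]mxE.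
have := qform_CauchySchwarz (delta_mx i 0) y hM.
rewrite hy mulr0 => h.
by apply/eqP; rewrite -inner_delta -sqrf_eq0 eq_le h sqr_ge0.
Qed.

(** The positive semidefinite cone is contained in its own dual.  A Schur
    complement step clears one row and column of [Y] at a time, splitting off
    a rank-one term, by induction on the number of rows not yet cleared. *)
Lemma inner_possemidef_ge0 P Y : possemidef P -> possemidef Y -> 0 <= inner P Y.
Proof.
move=> hP hY0; suff peel k : forall Z, possemidef Z ->
    (forall i j : 'I_n, (k <= i)%N -> Z i j = 0) -> 0 <= inner P Z.
  by apply: (peel n) => // i j; rewrite leqNgt ltn_ord.
elim: k => [|k IH] {hY0}Y hY hrow.
  have -> : Y = 0 by apply/matrixP => i j; rewrite hrow // mxE.
  by rewrite inner0r.
have [kn|nk] := ltnP k n; last first.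
  by apply: IH => // i j ki; have := leq_trans nk ki; rewrite leqNgt ltn_ord.
pose i := Ordinal kn; pose e : 'cV[R]_n := delta_mx i 0.
have [sY pY] := hY; have tY := (symmetricmxP _).1 sY.
have Yij l j : Y l j = Y j l by rewrite -{1}tY mxE.
pose a := Y i i.
have ea : inner e (Y *m e) = a by rewrite inner_delta mulmx_delta.
have a0 : 0 <= a by rewrite -ea.
have [az|an] := eqVneq a 0.
  apply: IH => // l j; rewrite leq_eqVlt => /orP[/eqP kl|/hrow//].
  have -> : l = i by apply/val_inj.
  have h := possemidef_ker (y := e) hY; rewrite ea in h.
  by rewrite Yij -mulmx_delta (h az) mxE.
have ap : 0 < a by rewrite lt_neqAle eq_sym an.
pose w := Y *m e; pose Z := Y - a^-1 *: (w *m w^T).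
have YZ : Y = Z + a^-1 *: (w *m w^T) by rewrite subrK.
rewrite YZ innerDr innerZr inner_mulmx_rank1 addr_ge0 //; last first.
  by rewrite mulr_ge0 ?invr_ge0 //; case: hP.
apply: IH.
  split.
    rewrite /Z -scaleNr; apply: symmetricmxD => //.
    by apply: symmetricmxZ; apply: symmetricmx_rank1.
  move=> z; rewrite /Z -scaleNr mulmxDl innerDr -scalemxAl innerZr qform_rank1.
  rewrite mulNr subr_ge0 mulrC ler_pdivrMr //.
  have -> : inner w z = inner e (Y *m z) by rewrite inner_trmx tY.
  by have := qform_CauchySchwarz e z hY; rewrite ea mulrC.
have ZE (v : 'cV[R]_n) l j :
    (Y - a^-1 *: (v *m v^T)) l j = Y l j - a^-1 * (v l 0 * v j 0).
  by rewrite !mxE big_ord1 mxE.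
move=> l j kl; rewrite ZE !mulmx_delta.
move: kl; rewrite leq_eqVlt => /orP[/eqP kl|kl].
  have -> : l = i by apply/val_inj.
  by rewrite (Yij j i) mulrA mulVf // mul1r subrr.
by rewrite !(hrow l) // mul0r mulr0 subr0.
Qed.

Lemma posdefW M : posdef M -> possemidef M.
Proof.
move=> [sM pM]; split=> // y; have [->|/pM/ltW//] := eqVneq y 0.
by rewrite mulmx0 inner0r.
Qed.

Lemma posdef_unit M : posdef M -> M \in unitmx.
Proof.
move=> [sM pM]; rewrite unitmxE unitfE; apply/det0P => -[v vn vM].
have vTn : v^T != 0 by apply: contraNneq vn => h; rewrite -[v]trmxK h trmx0.
have := pM _ vTn.
by rewrite inner_trmx -trmx_mul vM trmx0 inner0l ltxx.
Qed.

(** A positive definite matrix is interior to the semidefinite cone.  By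
    Cauchy-Schwarz for the form [M], each linear functional is bounded by a
    multiple of the square root of that form; this bounds the form of [B]
    from below by a multiple of that of [M]. *)
Lemma posdef_perturb M B : posdef M -> B \is symmetricmx ->
  exists2 e, 0 < e & forall t, 0 <= t -> t <= e -> possemidef (M + t *: B).
Proof.
move=> pM sB; have uM := posdef_unit pM; have hM := posdefW pM.
have [sM _] := hM; have tM := (symmetricmxP _).1 sM.
(* [rep u] represents the functional [inner u] in the inner product [M]. *)
pose rep u : 'cV[R]_n := invmx M *m u.
have repE u y : inner u y = inner (rep u) (M *m y).
  by rewrite inner_trmx tM mulmxA mulmxV // mul1mx.
pose N u := inner (rep u) (M *m rep u).
have N0 u : 0 <= N u by exact: hM.2.
have Nle u y : inner u y ^+ 2 <= N u * inner y (M *m y).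
  by rewrite repE; apply: qform_CauchySchwarz.
pose d i : 'cV[R]_n := delta_mx i 0.
pose K := \sum_i (N (d i) + N (B *m d i)).
have K0 : 0 <= K by apply: sumr_ge0 => i _; apply: addr_ge0.
have lb y : - (K * inner y (M *m y)) <= inner y (B *m y).
  rewrite (inner_coord y (B *m y)) /K mulr_suml -sumrN; apply: ler_sum => i _.
  have -> : (B *m y) i 0 = inner (B *m d i) y.
    by rewrite -inner_delta inner_trmx ((symmetricmxP _).1 sB).
  rewrite -(inner_delta i y) -/(d i).
  have h1 := Nle (d i) y; have h2 := Nle (B *m d i) y; nra.
exists (K + 1)^-1; first by rewrite invr_gt0 ltr_wpDl.
move=> t t0 te; split; first by apply: symmetricmxD => //; apply: symmetricmxZ.
move=> y; rewrite mulmxDl innerDr -scalemxAl innerZr.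
have tK : t * (K + 1) <= 1.
  by rewrite -ler_pdivlMr ?div1r // ltr_wpDl.
have h := lb y; have q0 : 0 <= inner y (M *m y) by exact: hM.2.
nra.
Qed.

Lemma quad_line M b c x y t : M \is symmetricmx ->
  quad M b c (x + t *: y) =
  quad M b c x + 2 * t * (inner y (M *m x) + inner b y)
  + t ^+ 2 * inner y (M *m y).
Proof.
move=> sM; rewrite /quad -{1 2}[x]scale1r qform_comb // innerDr innerZr.
by rewrite (inner_sym x y sM); ring.
Qed.

Lemma quad_comb M b c x y t : M \is symmetricmx ->
  quad M b c (t *: x + (1 - t) *: y) =
  t * quad M b c x + (1 - t) * quad M b c y
  - t * (1 - t) * inner (x - y) (M *m (x - y)).
Proof.
move=> sM; have -> : x - y = 1 *: x + (-1) *: y by rewrite scale1r scaleN1r.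
rewrite /quad !qform_comb // !innerDr !innerZr; ring.
Qed.

End Inner.

(** * Convex and conic hulls *)

Section Hulls.
Variables (R : realType) (n : nat).
Implicit Types (x y : 'cV[R]_n) (S K : set 'cV[R]_n).

Lemma convex_setI01 K :
  (forall x y (t : R), 0 <= t -> t <= 1 -> K x -> K y ->
     K (t *: x + (1 - t) *: y)) ->
  @convex_set R 'cV[R]_n K.
Proof.
move=> h x y l /set_mem Kx /set_mem Ky; apply/mem_set.
by apply: (h x y l%:num).
Qed.

Lemma convex_hull_segment S x y (t : R) : 0 <= t -> t <= 1 -> S x -> S y ->
  convex_hull S (t *: x + (1 - t) *: y).
Proof.
move=> t0 t1 Sx Sy K [cK SK].
have /set_mem := cK x y (Itv01 t0 t1) (mem_set (SK _ Sx)) (mem_set (SK _ Sy)).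
by [].
Qed.

Lemma conic_hull_pair (g h p : 'cV[R]_n) : conic_hull [set g; h] p ->
  exists s t, [/\ 0 <= s, 0 <= t & p = s *: g + t *: h].
Proof.
move=> /(_ [set p | exists s t, [/\ 0 <= s, 0 <= t & p = s *: g + t *: h]]).
apply; split; first split.
- by exists 0, 0; rewrite !scale0r addr0.
- move=> u v [s [t [s0 t0 ->]]] [s' [t' [s0' t0' ->]]].
  by exists (s + s'), (t + t'); rewrite !addr_ge0 // !scalerDl addrACA.
- move=> a u a0 [s [t [s0 t0 ->]]].
  by exists (a * s), (a * t); rewrite !mulr_ge0 // scalerDr !scalerA.
move=> u /= [->|->].
- by exists 1, 0; rewrite scale1r scale0r addr0.
- by exists 0, 1; rewrite scale1r scale0r add0r.
Qed.

End Hulls.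

(** * Aggregated quadratics *)

Section Aggregation.
Variables (R : realType) (n m : nat).
Variables (A : 'I_m -> 'M[R]_n) (b : 'I_m -> 'cV[R]_n) (c : 'I_m -> R).
Hypothesis hA : forall i, A i \is symmetricmx.
Implicit Types (g : 'cV[R]_m) (x y : 'cV[R]_n).

Lemma inner_aggregate p q (v : 'I_m -> 'M[R]_(p, q)) g X :
  inner (aggregate v g) X = \sum_i g i 0 * inner (v i) X.
Proof.
rewrite /aggregate (big_morph (fun U => inner U X) (id1 := 0) (op1 := +%R)).
- by apply: eq_bigr => i _; rewrite innerZl.
- by move=> U V; rewrite innerDl.
- by rewrite inner0l.
Qed.

Lemma aggregate_mulmx g x y :
  inner x (aggregate A g *m y) = \sum_i g i 0 * inner x (A i *m y).
Proof.
rewrite /aggregate mulmx_suml innerC.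
rewrite (big_morph (fun U => inner U x) (id1 := 0) (op1 := +%R)).
- by apply: eq_bigr => i _; rewrite -scalemxAl innerZl innerC.
- by move=> U V; rewrite innerDl.
- by rewrite inner0l.
Qed.

Lemma aggregateD (V : lmodType R) (v : 'I_m -> V) g h :
  aggregate v (g + h) = aggregate v g + aggregate v h.
Proof.
by rewrite /aggregate -big_split; apply: eq_bigr => i _; rewrite mxE scalerDl.
Qed.

Lemma aggregateZ (V : lmodType R) (v : 'I_m -> V) t g :
  aggregate v (t *: g) = t *: aggregate v g.
Proof.
by rewrite /aggregate scaler_sumr; apply: eq_bigr => i _; rewrite mxE scalerA.
Qed.

Lemma aggregate_delta (V : lmodType R) (v : 'I_m -> V) i :
  aggregate v (delta_mx i 0) = v i.
Proof.
rewrite /aggregate (bigD1 i) //= big1 ?addr0 => [|k kn].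
  by rewrite mxE !eqxx scale1r.
by rewrite mxE (negbTE kn) scale0r.
Qed.

Lemma aggregate_sym g : aggregate A g \is symmetricmx.
Proof.
rewrite /aggregate.
apply: (big_ind (fun M : 'M[R]_n => M \is symmetricmx)) => [||i _].
- by apply/symmetricmxP; rewrite trmx0.
- by move=> U V; apply: symmetricmxD.
- exact: symmetricmxZ.
Qed.

Lemma agg_quadE g x : agg_quad A b c g x =
  quad (aggregate A g) (aggregate b g) (\sum_i g i 0 * c i) x.
Proof.
rewrite /agg_quad /quad aggregate_mulmx inner_aggregate mulr_sumr.
rewrite -!big_split /=.
by apply: eq_bigr => i _; ring.
Qed.

Lemma ker_perpP g : ker_perp A b g <> [set 0] <->
  exists y, [/\ y != 0, aggregate A g *m y = 0 & inner (aggregate b g) y = 0].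
Proof.
split=> [h|[y [yn Ay by0]] h]; last first.
  have : ker_perp A b g y by split.
  by rewrite h => /= y0; rewrite y0 eqxx in yn.
apply: contrapT => hn; apply: h; apply/seteqP; split=> y /=.
  move=> [Ay by0]; apply: contrapT => /eqP yn; apply: hn.
  by exists y.
by move=> ->; split; [exact: mulmx0|exact: inner0r].
Qed.

Lemma feasible_subSDP : feasible A b c `<=` feasible_SDP A b c.
Proof.
move=> x Sx; exists (x *m x^T); split.
- exact: symmetricmx_rank1.
- rewrite subrr; split; first by apply/symmetricmxP; rewrite trmx0.
  by move=> y; rewrite mul0mx inner0r.
- by move=> i; rewrite inner_mulmx_rank1; apply: Sx.
Qed.

(** Weak duality between the relaxation and the aggregated constraints. *)
Lemma feasible_SDP_agg_le0 g x : Gamma1 A g -> feasible_SDP A b c x ->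
  agg_quad A b c g x <= 0.
Proof.
move=> [g0 pg] [X [sX pX hX]].
have h := inner_possemidef_ge0 pg pX.
have : \sum_i g i 0 * (inner (A i) X + 2 * inner (b i) x + c i) <= 0.
  by apply: sumr_le0 => i _; apply: mulr_ge0_le0.
move=> h2; apply: le_trans h2; rewrite -subr_ge0 -sumrB.
rewrite inner_aggregate in h.
apply: le_trans h _; apply: ler_sum => i _.
have -> : inner (A i) X = inner (A i) (X - x *m x^T) + inner x (A i *m x).
  by rewrite -inner_mulmx_rank1 -innerDr subrK.
rewrite /quad.
by rewrite le_eqVlt; apply/orP; left; apply/eqP; ring.
Qed.

Lemma agg_quad_convex g x y t :
  possemidef (aggregate A g) -> 0 <= t -> t <= 1 ->
  agg_quad A b c g (t *: x + (1 - t) *: y) <=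
  t * agg_quad A b c g x + (1 - t) * agg_quad A b c g y.
Proof.
move=> [sg pg] t0 t1; rewrite !agg_quadE quad_comb // gerBl.
by rewrite !mulr_ge0 // subr_ge0.
Qed.

End Aggregation.

Lemma sum_ord2 (V : nmodType) (i j : 'I_2) (F : 'I_2 -> V) : i != j ->
  \sum_k F k = F i + F j.
Proof.
move=> ij; rewrite (bigD1 i) //= (bigD1 j) ?(eq_sym j) //= big1 ?addr0 // => k.
by move: ij; case: i j k => [[|[|//]] ?] [[|[|//]] ?] [[|[|//]] ?].
Qed.

Lemma ord2P (i j k : 'I_2) : i != j -> k = i \/ k = j.
Proof.
case: i j k => [[|[|//]] ?] [[|[|//]] ?] [[|[|//]] ?] // _;
  by [left; apply/val_inj | right; apply/val_inj].
Qed.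

Lemma concave_root (R : realType) (p q a : R) : 0 < p -> a < 0 ->
  exists2 s, 0 < s & p + 2 * s * q + s ^+ 2 * a = 0.
Proof.
move=> p0 a0; pose d := q ^+ 2 - a * p.
have d0 : 0 < - (a * p) by rewrite oppr_gt0 nmulr_rlt0.
have dq : q ^+ 2 < d by rewrite /d ltrDl.
pose r := Num.sqrt d; have r2 : r ^+ 2 = d.
  by rewrite sqr_sqrtr // (le_trans (sqr_ge0 q) (ltW dq)).
have r0 : 0 <= r by exact: sqrtr_ge0.
have qr : 0 < q + r.
  have : `|q| < r.
    by rewrite -sqrtr_sqr ltr_sqrt // (le_lt_trans (sqr_ge0 q) dq).
  by rewrite ltr_norml => /andP[h _]; lra.
exists ((q + r) / (- a)); first by rewrite divr_gt0 // oppr_gt0.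
have an : a != 0 by rewrite lt_eqF.
apply: (mulfI an); rewrite mulr0.
have -> : a * (p + 2 * ((q + r) / - a) * q + ((q + r) / - a) ^+ 2 * a) =
  a * p - q ^+ 2 + r ^+ 2 by field.
by rewrite r2 /d; ring.
Qed.

(** * A pair of generators of the cone *)

Section GeneratingPair.
Variables (R : realType) (n : nat).
Variables (A : 'I_2 -> 'M[R]_n) (b : 'I_2 -> 'cV[R]_n) (c : 'I_2 -> R).
Hypothesis hA : forall i, A i \is symmetricmx.
Implicit Types (x y z w : 'cV[R]_n).

(** [g] and [h] generate [Gamma1 A], and [i], [j] label the two constraints so
    that [g] and [h], in the coordinates [(i, j)], have positive determinant:
    [g] is then the generator nearer to axis [i]. *)
Definition oriented_generators (i j : 'I_2) (g h : 'cV[R]_2) : Prop :=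
  [/\ Gamma1 A = conic_hull [set g; h], i != j
    & 0 < g i 0 * h j 0 - g j 0 * h i 0].

Lemma oriented_generatorsC i j g h :
  oriented_generators i j g h -> oriented_generators j i h g.
Proof.
by move=> [e ij D]; split; rewrite 1?setUC 1?eq_sym // mulrC [h i 0 * _]mulrC.
Qed.

(** Some nonnegative aggregate of the [A i] is positive definite. *)
Definition pd_aggregate : Prop := exists ghat : 'cV[R]_2,
  nonneg_orthant ghat /\ posdef (aggregate A ghat).

(** The two generators are linearly independent: the weight vector of a
    positive definite aggregate can be pushed a little along both axes without
    leaving [Gamma1 A], and the two resulting vectors are independent. *)
Lemma generators_oriented g h :
  pd_aggregate -> Gamma1 A = conic_hull [set g; h] ->
  exists i j, oriented_generators i j g h.
Proof.
move=> [p [p0 pp]] gen.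
pose d k : 'cV[R]_2 := delta_mx k 0.
have push k : exists2 e, 0 < e &
    forall t, 0 <= t -> t <= e -> Gamma1 A (p + t *: d k).
  have [e e0 he] := posdef_perturb pp (hA k).
  exists e => // t t0 te; split.
    by move=> l; rewrite !mxE addr_ge0 // mulr_ge0.
  by rewrite aggregateD aggregateZ aggregate_delta; apply: he.
have [e0 e0p h0] := push 0; have [e1 e1p h1] := push 1.
pose e := Num.min e0 e1; have ep : 0 < e by rewrite lt_min e0p.
have := h0 e (ltW ep); rewrite ge_min lexx => /(_ isT).
have := h1 e (ltW ep); rewrite ge_min lexx orbT => /(_ isT).
rewrite gen => /conic_hull_pair [s1 [t1 [_ _ E1]]].
move=> /conic_hull_pair [s0 [t0 [_ _ E0]]].
have := congr1 (fun M : 'cV[R]_2 => M 0 0) E0.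
have := congr1 (fun M : 'cV[R]_2 => M 1 0) E0.
have := congr1 (fun M : 'cV[R]_2 => M 0 0) E1.
have := congr1 (fun M : 'cV[R]_2 => M 1 0) E1.
rewrite !mxE /= !mulr1 !mulr0 !addr0 => q11 q10 q01 q00.
have dp : 0 < (p 0 0 + e) * (p 1 0 + e) - p 0 0 * p 1 0.
  have a0 := p0 0; have a1 := p0 1; nra.
have : (p 0 0 + e) * (p 1 0 + e) - p 0 0 * p 1 0 =
   (s0 * t1 - t0 * s1) * (g 0 0 * h 1 0 - g 1 0 * h 0 0).
  by rewrite q00 q11 q01 q10; ring.
set D := g 0 0 * h 1 0 - g 1 0 * h 0 0 => E.
have Dn : D != 0 by apply: contraTneq dp => D0; rewrite E D0 mulr0 ltxx.
case: (ltgtP D 0) => [D0|D0|D0]; last by rewrite D0 eqxx in Dn.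
- exists 1, 0; split=> //; move: D0; rewrite /D => D0; lra.
- by exists 0, 1; split.
Qed.

Variables (i j : 'I_2) (g h : 'cV[R]_2).
Hypothesis pdA : pd_aggregate.
Hypothesis ogh : oriented_generators i j g h.

Let D0 : 0 < g i 0 * h j 0 - g j 0 * h i 0. Proof. by case: ogh. Qed.
Let ij : i != j. Proof. by case: ogh. Qed.
Local Notation Q := (agg_quad A b c g).
Local Notation P := (agg_quad A b c h).
Local Notation q k := (quad (A k) (b k) (c k)).
Local Notation D := (g i 0 * h j 0 - g j 0 * h i 0).

Lemma generator_l : Gamma1 A g.
Proof. by case: ogh => -> _ _ K [_]; apply; left. Qed.

Lemma generator_r : Gamma1 A h.
Proof. by case: ogh => -> _ _ K [_]; apply; right. Qed.

Let gam_ge0 k : 0 <= g k 0. Proof. exact: generator_l.1. Qed.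
Let eta_ge0 k : 0 <= h k 0. Proof. exact: generator_r.1. Qed.

Lemma agg_quad_ord2E x : Q x = g i 0 * q i x + g j 0 * q j x.
Proof. exact: sum_ord2. Qed.

Lemma quad_from_aggregates x : D * q i x = h j 0 * Q x - g j 0 * P x.
Proof. by rewrite agg_quad_ord2E /agg_quad (sum_ord2 _ ij); ring. Qed.

(** A generator in the open orthant lies on the boundary of the semidefinite
    constraint: if [aggregate A g] were positive definite, then [g - t h] would
    be in [Gamma1 A] for a small [t > 0], which is impossible because [g] and
    [h] are independent generators. *)
Lemma null_vector_exists :
  pos_orthant g ->
  exists2 y : 'cV[R]_n, y != 0 & aggregate A g *m y = 0.
Proof.
move=> gp; apply: contrapT => hn.
have pg := generator_l.2.
have pd : posdef (aggregate A g).
  split=> [|y yn]; first by case: pg.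
  rewrite lt_neqAle pg.2 andbT eq_sym; apply: contra_notN hn => /eqP hy.
  by exists y => //; apply: possemidef_ker.
have [e e0 he] := posdef_perturb pd
  (symmetricmxZ (-1) (aggregate_sym hA h)).
pose m := Num.min (g i 0) (g j 0).
have m0 : 0 < m by rewrite lt_min !gp.
(* [t <= m / M] keeps both entries of [g - t h] nonnegative. *)
pose M := h i 0 + h j 0 + 1.
have hi := eta_ge0 i; have hj := eta_ge0 j.
have M0 : 0 < M by rewrite /M; lra.
pose t := Num.min e (m / M).
have t0 : 0 < t by rewrite lt_min e0 divr_gt0.
have tM : t * M <= m by rewrite -ler_pdivlMr // ge_min lexx orbT.
have [gen _ _] := ogh.
have : Gamma1 A (g + t *: (- h)).
  split.
    move=> k; rewrite !mxE mulrN subr_ge0.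
    have mi : m <= g i 0 by rewrite ge_min lexx.
    have mj : m <= g j 0 by rewrite ge_min lexx orbT.
    case: (ord2P k ij) => ->; move: tM mi mj; rewrite /M; nra.
  rewrite aggregateD aggregateZ -scaleN1r aggregateZ.
  by apply: he; rewrite ?(ltW t0) // ge_min lexx.
rewrite gen => /conic_hull_pair [s [r [_ r0 E]]].
have := congr1 (fun M : 'cV[R]_2 => M i 0) E.
have := congr1 (fun M : 'cV[R]_2 => M j 0) E.
rewrite !mxE => Ej Ei.
have : (r + t) * D = 0.
  have -> : (r + t) * (g i 0 * h j 0 - g j 0 * h i 0) =
    g i 0 * (s * g j 0 + r * h j 0) - g j 0 * (s * g i 0 + r * h i 0) +
    t * (g i 0 * h j 0 - g j 0 * h i 0) by ring.
  by rewrite -Ej -Ei; ring.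
by apply/eqP; rewrite mulf_neq0 // gt_eqF // ltr_wpDl.
Qed.

(** The weight vector of a positive definite aggregate is a nonnegative
    combination of [g] and [h], and [g] does not contribute at [y]. *)
Lemma null_vector_pos y : y != 0 -> aggregate A g *m y = 0 ->
  0 < inner y (aggregate A h *m y).
Proof.
move=> yn y0; have [p [p0 pp]] := pdA.
have : Gamma1 A p by split=> //; apply: posdefW.
have [gen _ _] := ogh.
rewrite gen => /conic_hull_pair [s [t [_ t0 E]]].
have := pp.2 y yn; rewrite E aggregateD !aggregateZ mulmxDl -!scalemxAl y0.
rewrite scaler0 add0r innerZr => ty.
by move: t0; rewrite le_eqVlt => /orP[/eqP t0|t0];
  [rewrite -t0 mul0r ltxx in ty|rewrite pmulr_rgt0 in ty].
Qed.

Lemma null_vector_neg y : 0 < g j 0 -> y != 0 -> aggregate A g *m y = 0 ->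
  inner y (A i *m y) < 0.
Proof.
move=> gj yn y0; have := null_vector_pos yn y0.
have : inner y (aggregate A g *m y) = 0 by rewrite y0 inner0r.
rewrite !aggregate_mulmx !(sum_ord2 _ ij) => e1 e2.
have e3 : 0 < g j 0 * (h i 0 * inner y (A i *m y) + h j 0 * inner y (A j *m y)).
  exact: mulr_gt0.
rewrite -(pmulr_rlt0 _ D0).
have -> : (g i 0 * h j 0 - g j 0 * h i 0) * inner y (A i *m y) =
 h j 0 * (g i 0 * inner y (A i *m y) + g j 0 * inner y (A j *m y)) -
 g j 0 * (h i 0 * inner y (A i *m y) + h j 0 * inner y (A j *m y)) by ring.
by rewrite e1 mulr0 sub0r oppr_lt0.
Qed.

(** Only a generator with positive entries can be responsible for a point that
    satisfies both aggregated constraints but violates [q i]. *)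
Lemma violated_pos x : Q x <= 0 -> P x <= 0 -> 0 < q i x -> pos_orthant g.
Proof.
move=> Qx Px qx; have := mulr_gt0 D0 qx; rewrite quad_from_aggregates => e.
have gi := gam_ge0 i; have gj := gam_ge0 j.
have hi := eta_ge0 i; have hj := eta_ge0 j.
have e1 := mulr_ge0_le0 hj Qx; have e2 := mulr_ge0_le0 gj Px.
move=> k; case: (ord2P k ij) => ->; rewrite lt_neqAle eq_sym ?gi ?gj andbT.
  apply: contraTneq D0 => gi0; rewrite gi0 mul0r sub0r oppr_gt0 -leNgt.
  exact: mulr_ge0.
apply: contraTneq e => gj0; rewrite gj0 mul0r subr0 -leNgt //.
Qed.

Lemma face_violated x : 0 < g j 0 -> Q x = 0 -> (0 < q i x) = (P x < 0).
Proof.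
move=> gj Qx; rewrite -(pmulr_rgt0 _ D0) quad_from_aggregates Qx mulr0.
by rewrite sub0r oppr_gt0 pmulr_rlt0.
Qed.

Lemma quad_null_line y x t : aggregate A g *m y = 0 ->
  Q (x + t *: y) = Q x + 2 * t * inner (aggregate b g) y.
Proof.
move=> y0; rewrite !agg_quadE quad_line ?aggregate_sym //.
rewrite (inner_sym y x (aggregate_sym hA g)) y0 !inner0r.
by rewrite mulr0 add0r addr0.
Qed.

Lemma boundary_feasible x : 0 < g j 0 -> q i x = 0 -> Q x <= 0 ->
  feasible A b c x.
Proof.
move=> gj qx; rewrite agg_quad_ord2E qx mulr0 add0r (pmulr_rle0 _ gj) => qj k.
by case: (ord2P k ij) => -> //; rewrite qx.
Qed.

(** Requirement on the generator [g]: if [h] is strictly satisfied somewhere on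
    the zero set of the quadratic aggregated by [g], then [ker_perp A b g] is
    not trivial. *)
Definition face_degenerate : Prop :=
  (exists x, Q x = 0 /\ P x < 0) -> ker_perp A b g <> [set 0].

(** Moving along a kernel vector [w] of [aggregate A g] until [q i] vanishes
    reaches a feasible point, because the quadratic aggregated by [g] is still
    nonpositive there: either it is constant along [w], or [ker_perp A b g] is
    trivial, and then a positive value would make it vanish earlier on the way,
    where [q i] is still positive, contrary to [face_degenerate]. *)
Lemma slide_feasible x w : face_degenerate ->
  Q x <= 0 -> 0 < q i x -> pos_orthant g -> w != 0 ->
  aggregate A g *m w = 0 ->
  (inner (aggregate b g) w = 0 \/ ker_perp A b g = [set 0]) ->
  exists2 s, 0 < s & feasible A b c (x + s *: w).
Proof.
move=> fd Qx qx gp wn w0 alt.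
have nw := null_vector_neg (gp j) wn w0.
have [s s0 hs] := concave_root (inner w (A i *m x) + inner (b i) w) qx nw.
have qs : q i (x + s *: w) = 0 by rewrite quad_line.
exists s => //; apply: boundary_feasible => //.
case: alt => [bw|k0]; first by rewrite quad_null_line // bw mulr0 addr0.
rewrite leNgt; apply/negP => Qs.
have dQ : 0 < Q (x + s *: w) - Q x by rewrite subr_gt0 (le_lt_trans Qx).
(* [l] is the weight at which the affine function [Q] vanishes. *)
pose l := Q (x + s *: w) / (Q (x + s *: w) - Q x).
have l0 : 0 < l by rewrite divr_gt0.
have l1 : l <= 1 by rewrite ler_pdivrMr // mul1r lerBrDr gerDl.
pose z := l *: x + (1 - l) *: (x + s *: w).
have xz : x - (x + s *: w) = (- s) *: w by rewrite opprD addNKr scaleNr.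
have Qz : Q z = 0.
  rewrite agg_quadE quad_comb ?aggregate_sym // -!agg_quadE xz.
  rewrite -scalemxAr w0 scaler0 inner0r mulr0 subr0 /l.
  by field; rewrite gt_eqF.
have qz : 0 < q i z.
  rewrite quad_comb // qs mulr0 addr0 xz.
  rewrite -scalemxAr innerZr innerZl.
  have lq := mulr_gt0 l0 qx.
  have l1' : 0 <= 1 - l by rewrite subr_ge0.
  have n' : 0 <= - inner w (A i *m w) by rewrite oppr_ge0 ltW.
  have := mulr_ge0 (mulr_ge0 (ltW l0) l1') (mulr_ge0 (sqr_ge0 s) n').
  by move=> h1; lra.
apply: (fd _ k0); exists z; split=> //.
by rewrite -(face_violated (gp j) Qz).
Qed.

Lemma violated_in_convex_hull x :
  face_degenerate -> Q x <= 0 -> P x <= 0 -> 0 < q i x ->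
  convex_hull (feasible A b c) x.
Proof.
move=> fd Qx Px qx; have gp := violated_pos Qx Px qx.
have [w [wn w0 alt]] : exists w, [/\ w != 0, aggregate A g *m w = 0 &
    inner (aggregate b g) w = 0 \/ ker_perp A b g = [set 0]].
  have [k0|/ker_perpP [w [wn w0 bw]]] := pselect (ker_perp A b g = [set 0]).
    by have [w wn w0] := null_vector_exists gp; exists w; split=> //; right.
  by exists w; split=> //; left.
have [s s0 Ss] := slide_feasible fd Qx qx gp wn w0 alt.
have [t t0 St] : exists2 t, 0 < t & feasible A b c (x + t *: - w).
  apply: slide_feasible => //; first by rewrite oppr_eq0.
    by rewrite mulmxN w0 oppr0.
  by case: alt => [bw|]; [left; rewrite -scaleN1r innerZr bw mulr0|right].
have st : 0 < s + t by rewrite addr_gt0.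
pose l := t / (s + t).
have -> : x = l *: (x + s *: w) + (1 - l) *: (x + t *: - w).
  rewrite !scalerDr addrACA -scalerDl [l + _]addrC subrK scale1r.
  rewrite scalerN scalerN !scalerA -scalerBl.
  have -> : l * s - (1 - l) * t = 0 by rewrite /l; field; rewrite gt_eqF.
  by rewrite scale0r addr0.
apply: convex_hull_segment => //.
  by rewrite divr_ge0 // ltW.
by rewrite ler_pdivrMr // mul1r lerDr ltW.
Qed.

(** The multiple [t] of [y y^T] is chosen to turn the lifted constraint [i] into
    an equality; the lifted constraint [j] then has the sign of [Q x]. *)
Lemma lift_SDP x : Q x <= 0 -> P x <= 0 -> 0 < q i x -> feasible_SDP A b c x.
Proof.
move=> Qx Px qx; have gp := violated_pos Qx Px qx.
have [y yn y0] := null_vector_exists gp.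
have ny := null_vector_neg (gp j) yn y0.
pose t := - q i x / inner y (A i *m y).
have t0 : 0 < t by rewrite /t nmulr_rgt0 ?oppr_lt0 // invr_lt0.
have qi : q i x + t * inner y (A i *m y) = 0.
  by rewrite /t divfK ?subrr // lt_eqF.
exists (x *m x^T + t *: (y *m y^T)); split.
- apply: symmetricmxD; first exact: symmetricmx_rank1.
  by apply: symmetricmxZ; apply: symmetricmx_rank1.
- rewrite addrAC subrr add0r; split.
    by apply: symmetricmxZ; apply: symmetricmx_rank1.
  move=> z; rewrite -scalemxAl innerZr qform_rank1.
  by rewrite mulr_ge0 ?sqr_ge0 // ltW.
have qE k : inner (A k) (x *m x^T + t *: (y *m y^T)) + 2 * inner (b k) x + c k =
   q k x + t * inner y (A k *m y).
  by rewrite innerDr innerZr !inner_mulmx_rank1 /quad; ring.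
move=> k; rewrite qE; case: (ord2P k ij) => ->; first by rewrite qi.
rewrite -(pmulr_rle0 _ (gp j)).
have : inner y (aggregate A g *m y) = 0 by rewrite y0 inner0r.
rewrite aggregate_mulmx (sum_ord2 _ ij) => e.
have -> : g j 0 * (q j x + t * inner y (A j *m y)) =
  Q x - g i 0 * (q i x + t * inner y (A i *m y)) +
  t * (g i 0 * inner y (A i *m y) + g j 0 * inner y (A j *m y)).
  by rewrite agg_quad_ord2E; ring.
by rewrite e qi !mulr0 subr0 addr0.
Qed.

(** If [ker_perp A b g] were trivial, such an [x] would be an extreme point of
    [{Q <= 0}], so that removing it from this set would leave a convex set
    containing the feasible points. *)
Lemma face_extreme x : pos_orthant g -> Q x = 0 -> P x < 0 ->
  convex_hull (feasible A b c) x -> ker_perp A b g <> [set 0].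
Proof.
move=> gp Qx Px hx k0.
have Sle G z : Gamma1 A G -> feasible A b c z -> agg_quad A b c G z <= 0.
  by move=> GG /feasible_subSDP; apply: feasible_SDP_agg_le0.
have pg := generator_l.2.
have := hx [set z | Q z <= 0 /\ z <> x]; case=> //; split.
  apply: convex_setI01 => y z t t0 t1 [Qy yx] [Qz zx]; split.
    apply: le_trans (agg_quad_convex b c y z pg t0 t1) _.
    by nra.
  move=> E.
  have e1 : x - z = t *: (y - z).
    by rewrite -E scalerBl scale1r scalerBr -addrA [z - _]addrC addrK.
  have tn : t != 0.
    apply: contra_notN zx => /eqP tz; move: e1; rewrite tz scale0r => /eqP.
    by rewrite subr_eq0 => /eqP.
  have t1n : 1 - t != 0.
    apply: contra_notN yx => /eqP tz; rewrite -E tz scale0r addr0.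
    have -> : t = 1 by lra.
    by rewrite scale1r.
  have yz : y - z != 0.
    apply: contra_notN zx => /eqP tz; move: e1; rewrite tz scaler0 => /eqP.
    by rewrite subr_eq0 => /eqP.
  have gap := quad_comb (aggregate b g) (\sum_k g k 0 * c k) y z t pg.1.
  rewrite E -!agg_quadE Qx in gap.
  have yz0 : inner (y - z) (aggregate A g *m (y - z)) = 0.
    have tp : 0 < t by rewrite lt_neqAle eq_sym tn.
    have t1p : 0 < 1 - t by rewrite lt_neqAle eq_sym t1n subr_ge0.
    apply/eqP; rewrite eq_le pg.2 andbT leNgt; apply/negP => hp.
    have := mulr_gt0 (mulr_gt0 tp t1p) hp.
    have := mulr_ge0_le0 (ltW tp) Qy; have := mulr_ge0_le0 (ltW t1p) Qz.
    by lra.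
  have ker := possemidef_ker pg yz0.
  have : ker_perp A b g (y - z).
    split=> //=.
    have yE : y = z + 1 *: (y - z) by rewrite scale1r addrC subrK.
    have Qyz := quad_null_line z 1 ker; rewrite -yE in Qyz.
    rewrite yz0 mulr0 subr0 in gap.
    have Qz0 : Q z = 0.
      apply/eqP; rewrite eq_le Qz /= -(pmulr_rge0 (Q z) (x := 1 - t)).
        by have := mulr_ge0_le0 t0 Qy; lra.
      by rewrite lt_neqAle eq_sym t1n subr_ge0.
    have Qy0 : Q y = 0.
      apply/eqP; rewrite eq_le Qy /= -(pmulr_rge0 (Q y) (x := t)).
        by rewrite Qz0 in gap; lra.
      by rewrite lt_neqAle eq_sym tn.
    by rewrite Qz0 Qy0 in Qyz; rewrite /Defs.orthogonal /=; lra.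
  by rewrite k0 => /= /eqP; rewrite (negbTE yz).
move=> z Sz; split; first exact: Sle generator_l Sz.
move=> zx; have := face_violated (gp j) Qx; rewrite Px -zx.
by rewrite ltNge; have /= -> := Sz i.
Qed.

End GeneratingPair.

(** * Exactness of the relaxation *)

Section Exactness.
Variables (R : realType) (n : nat).
Variables (A : 'I_2 -> 'M[R]_n) (b : 'I_2 -> 'cV[R]_n) (c : 'I_2 -> R).
Hypothesis hA : forall i, A i \is symmetricmx.
Hypothesis pdA : pd_aggregate A.
Variables (i j : 'I_2) (g h : 'cV[R]_2).
Hypothesis ogh : oriented_generators A i j g h.
Implicit Types (x y z w : 'cV[R]_n).

Let ohg : oriented_generators A j i h g := oriented_generatorsC ogh.

(** The relaxation is cut out by the two aggregated constraints. *)
Lemma feasible_SDPP x : feasible_SDP A b c x <->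
  agg_quad A b c g x <= 0 /\ agg_quad A b c h x <= 0.
Proof.
split=> [Sx|[Qx Px]].
  by split; apply: feasible_SDP_agg_le0 => //;
    [exact: generator_l ogh|exact: generator_r ogh].
have [qi|qi] := ltP 0 (quad (A i) (b i) (c i) x).
  exact: (lift_SDP hA pdA ogh).
have [qj|qj] := ltP 0 (quad (A j) (b j) (c j) x).
  exact: (lift_SDP hA pdA ohg).
apply: feasible_subSDP => k; have [_ ij _] := ogh.
by case: (ord2P k ij) => ->.
Qed.

Lemma convex_hull_subSDP : convex_hull (feasible A b c) `<=` feasible_SDP A b c.
Proof.
apply: smallest_sub; last exact: feasible_subSDP.
apply: convex_setI01 => x y t t0 t1 /feasible_SDPP[Qx Px] /feasible_SDPP[Qy Py].
have pg := (generator_l ogh).2; have ph := (generator_r ogh).2.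
have s0 : 0 <= 1 - t by rewrite subr_ge0.
apply/feasible_SDPP; split.
- apply: le_trans (agg_quad_convex b c x y pg t0 t1) _.
  by rewrite -oppr_ge0 opprD -!mulrN addr_ge0 // mulr_ge0 // oppr_ge0.
- apply: le_trans (agg_quad_convex b c x y ph t0 t1) _.
  by rewrite -oppr_ge0 opprD -!mulrN addr_ge0 // mulr_ge0 // oppr_ge0.
Qed.

Lemma exact_degenerate : convex_hull (feasible A b c) = feasible_SDP A b c ->
  pos_orthant g -> face_degenerate A b c g h.
Proof.
move=> E gp; rewrite /face_degenerate => -[x [Qx Px]].
apply: (face_extreme hA ogh gp Qx Px).
rewrite E; apply/feasible_SDPP.
by rewrite Qx lexx ltW.
Qed.

Lemma pos_generator : (forall k, ~ possemidef (A k)) -> pos_orthant g.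
Proof.
move=> nA; have [gen ij D] := ogh.
have [g0 pg] := generator_l ogh; have [h0 _] := generator_r ogh.
have gi : 0 < g i 0.
  rewrite lt_neqAle g0 eq_sym andbT; apply: contraTneq D => ->.
  by rewrite mul0r sub0r oppr_gt0 -leNgt mulr_ge0.
move=> k; case: (ord2P k ij) => -> //.
rewrite lt_neqAle g0 eq_sym andbT; apply/eqP => gj; apply: (nA i).
split=> // y; rewrite -(pmulr_rge0 _ gi).
by have := pg.2 y; rewrite aggregate_mulmx (sum_ord2 _ ij) gj mul0r addr0.
Qed.

(** From a point strictly satisfying both aggregated constraints, moving along a
    kernel vector [w] of [aggregate A h] with [inner (aggregate b h) w <= 0]
    keeps the constraint of [h] strict, while that of [g] is strictly convex
    along [w] and so reaches equality. *)
Lemma face_witness x : pos_orthant h ->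
  agg_quad A b c g x < 0 -> agg_quad A b c h x < 0 ->
  exists z, agg_quad A b c g z = 0 /\ agg_quad A b c h z < 0.
Proof.
move=> hp Qx Px; have [w0 w0n kw0] := null_vector_exists hA ohg hp.
have [w [wn kw bw]] : exists w, [/\ w != 0, aggregate A h *m w = 0 &
    inner (aggregate b h) w <= 0].
  have [bw|bw] := leP (inner (aggregate b h) w0) 0; first by exists w0.
  exists (- w0); split; rewrite ?oppr_eq0 ?mulmxN ?kw0 ?oppr0 //.
  by rewrite -scaleN1r innerZr mulN1r oppr_le0 ltW.
have nw := null_vector_pos pdA ohg wn kw.
have sg := aggregate_sym hA g.
have Qx' : 0 < - agg_quad A b c g x by rewrite oppr_gt0.
have nw' : - inner w (aggregate A g *m w) < 0 by rewrite oppr_lt0.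
have [s s0 hs] := concave_root
  (- (inner w (aggregate A g *m x) + inner (aggregate b g) w)) Qx' nw'.
exists (x + s *: w); split.
  rewrite agg_quadE quad_line // -agg_quadE.
  by move: hs; rewrite !mulrN -!opprD => /eqP; rewrite oppr_eq0 => /eqP.
rewrite (quad_null_line b c hA x s kw).
have := mulr_ge0_le0 (ltW s0) bw; lra.
Qed.

End Exactness.

Section Characterisation.
Variables (R : realType) (n : nat).
Variables (A : 'I_2 -> 'M[R]_n) (b : 'I_2 -> 'cV[R]_n) (c : 'I_2 -> R).
Hypothesis hA : forall i, A i \is symmetricmx.
Hypothesis pdA : pd_aggregate A.
Variables (i j : 'I_2) (g h : 'cV[R]_2).
Hypothesis ogh : oriented_generators A i j g h.

Let ohg : oriented_generators A j i h g := oriented_generatorsC ogh.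

Lemma exactnessP : convex_hull (feasible A b c) = feasible_SDP A b c <->
  (pos_orthant g -> face_degenerate A b c g h) /\
  (pos_orthant h -> face_degenerate A b c h g).
Proof.
split=> [E|[dg dh]].
  split; first exact (exact_degenerate hA pdA ogh E).
  exact (exact_degenerate hA pdA ohg E).
apply/seteqP; split; first exact: (convex_hull_subSDP hA pdA ogh).
move=> x /(feasible_SDPP b c hA pdA ogh) [Qx Px].
have [qi|qi] := ltP 0 (quad (A i) (b i) (c i) x).
  apply: (violated_in_convex_hull hA pdA ogh) => //; apply: dg.
  exact: (violated_pos ogh Qx Px qi).
have [qj|qj] := ltP 0 (quad (A j) (b j) (c j) x).
  apply: (violated_in_convex_hull hA pdA ohg) => //; apply: dh.
  exact: (violated_pos ohg Px Qx qj).
apply: sub_gen_smallest => k; have [_ ij _] := ogh.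
by case: (ord2P k ij) => ->.
Qed.

Lemma exactness_nonconvexP : (forall k, ~ possemidef (A k)) ->
  (exists x, forall k, quad (A k) (b k) (c k) x < 0) ->
  convex_hull (feasible A b c) = feasible_SDP A b c <->
  ker_perp A b g <> [set 0] /\ ker_perp A b h <> [set 0].
Proof.
move=> nA [x qx]; rewrite exactnessP.
have gp := pos_generator hA ogh nA; have hp := pos_generator hA ohg nA.
have neg G : pos_orthant G -> agg_quad A b c G x < 0.
  move=> Gp; have [_ ij _] := ogh.
  rewrite /agg_quad (sum_ord2 _ ij) -oppr_gt0 opprD -!mulrN.
  by rewrite addr_gt0 // mulr_gt0 // oppr_gt0.
rewrite /face_degenerate; split=> [[dg dh]|[kg kh]]; last by split.
split; [apply: (dg gp)|apply: (dh hp)].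
  by apply: (face_witness hA pdA ogh hp); apply: neg.
by apply: (face_witness hA pdA ohg gp); apply: neg.
Qed.

End Characterisation.

Lemma quad_convex_function (R : realType) (n : nat) (M : 'M[R]_n)
    (u : 'cV[R]_n) (d : R) : possemidef M ->
  convex_function (setT : set (convex_lmodType 'cV[R]_n)) (quad M u d).
Proof.
move=> [sM pM] t x y _ _.
change (quad M u d (t%:num *: (x : 'cV[R]_n) + (1 - t%:num) *: (y : 'cV[R]_n))
  <= t%:num * quad M u d x + (1 - t%:num) * quad M u d y).
by rewrite quad_comb // gerBl; apply: mulr_ge0.
Qed.

Theorem lemma5 (R : realType) (n : nat) (hn : (0 < n)%N)
    (A : 'I_2 -> 'M[R]_n) (b : 'I_2 -> 'cV[R]_n) (c : 'I_2 -> R)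
    (hA : forall i, A i \is symmetricmx)
    (hdef : exists ghat : 'cV[R]_2,
        nonneg_orthant ghat /\ posdef (aggregate A ghat))
    (g1 g2 : 'cV[R]_2)
    (hg1 : nonneg_orthant g1) (hg2 : nonneg_orthant g2)
    (hgen : Gamma1 A = conic_hull [set g1; g2]) :
  (convex_hull (feasible A b c) = feasible_SDP A b c <->
     (pos_orthant g1 ->
      (exists x, agg_quad A b c g1 x = 0 /\ agg_quad A b c g2 x < 0) ->
      ker_perp A b g1 <> [set 0])
     /\
     (pos_orthant g2 ->
      (exists x, agg_quad A b c g2 x = 0 /\ agg_quad A b c g1 x < 0) ->
      ker_perp A b g2 <> [set 0]))
  /\
  ((forall i, ~ convex_function (setT : set (convex_lmodType 'cV[R]_n))
                  (quad (A i) (b i) (c i))) ->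
   (exists xhat, forall i, quad (A i) (b i) (c i) xhat < 0) ->
   (convex_hull (feasible A b c) = feasible_SDP A b c <->
      ker_perp A b g1 <> [set 0] /\ ker_perp A b g2 <> [set 0])).
Proof.
have [i [j og]] := generators_oriented hA hdef hgen.
split; first exact (exactnessP b c hA hdef og).
move=> nq slater; apply: (exactness_nonconvexP hA hdef og _ slater) => k pA.
exact: (nq k (quad_convex_function (b k) (c k) pA)).
Qed.
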